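(* Let $X$ be a real tree which is an asymptotic cone of a finitely generated group, i.e. $X$ is isometric to $C_S(G,g,\nu)$ for some finitely generated group $G$, some finite generating set $S=S^{-1}$ of $G$, some $g\in{}^*G$ and some $\nu\in{}^*\mathbb{R}$ with $\nu\gg1$. Then $X$ is a point, or $X$ is a line (isometric to $\mathbb{R}$), or $X$ is a real tree with valency $2^{\aleph_0}$ at each point.
   Context: Nonstandard extensions. Fix a non-principal ultrafilter $\mathcal{U}$ on $\mathbb{N}$. For a set $X$, ${}^*X$ is the ultrapower $X^{\mathbb{N}}/\mathcal{U}$ (functions identified if they agree on a set in $\mathcal{U}$), with $X\subseteq{}^*X$ via constant functions; functions and relations (in particular the order and operations of $\mathbb{R}$ and the metric $d$ of a metric space, giving $d:{}^*X\times{}^*X\to{}^*\mathbb{R}$) are extended componentwise modulo $\mathcal{U}$. For $\xi,\eta\in{}^*\mathbb{R}$, $\eta\neq 0$: $\xi\in o(\eta)$ means $\xi/\eta$ is infinitesimal; $\xi\in O(\eta)$ means $\xi/\eta$ is finite, i.e. bounded in absolute value by a standard real; $\xi\gg\eta$ means $\xi,\eta$ are nonnegative and $\xi/\eta$ is infinite. For finite $\xi\in{}^*\mathbb{R}$, $st(\xi)$ is the unique real with $\xi-st(\xi)$ infinitesimal. Asymptotic cones. Let $(Y,d)$ be a metric space, $p\in{}^*Y$ (basepoint) and $\nu\in{}^*\mathbb{R}$, $\nu\gg 1$ (scaling factor). On ${}^*Y$ put $x\sim y\iff d(x,y)\in o(\nu)$. The asymptotic cone is $C(Y,p,\nu)=\{[x]\in{}^*Y/{\sim}\,:\,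 d(x,p)\in O(\nu)\}$ with metric $d([x],[y])=st(d(x,y)/\nu)$. Asymptotic cones of groups. For a finitely generated group $G$ and a finite generating set $S=S^{-1}$, the Cayley graph $\mathcal{CG}_S(G)$ has vertex set $G$ and an edge of length 1 between $g$ and $h$ iff $gs=h$ for some $s\in S$; it is endowed with the path metric. For $g\in{}^*G$ and $\nu\gg1$, $C_S(G,g,\nu)=C(\mathcal{CG}_S(G),g,\nu)$. Real trees. A geodesic in a metric space $X$ is a map $\gamma:[0,l]\to X$ with $d(\gamma(t),\gamma(s))=|t-s|$ for all $t,s$; $X$ is geodesic if any two points are joined by a geodesic. A real tree is a complete geodesic metric space in which every geodesic triangle is a tripod, i.e. each side is contained in the union of the other two. The valency of a real tree $T$ at $p\in T$ is the number (cardinality of the set) of connected components of $T\setminus\{p\}$. *)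

(* Defs.v *)
From HB Require Import structures.
From mathcomp Require Import all_boot all_order all_algebra.
From mathcomp Require Import all_classical all_reals.
From mathcomp Require Import lra.
From mathcomp Require Import topology normedtype sequences realfun.

Set Implicit Arguments.
Unset Strict Implicit.
Unset Printing Implicit Defensive.

Import Order.TTheory GRing.Theory Num.Theory.
Import numFieldNormedType.Exports.

Local Open Scope classical_set_scope.
Local Open Scope ring_scope.
Local Open Scope quotient_scope.

Record nonprincipal_ultrafilter := NonprincipalUltrafilter {
  ultra_sets : set_system nat ;
  ultra_ultra : UltraFilter ultra_sets ;
  ultra_nonprincipal : forall n : nat, ~ ultra_sets [set n]
}.

#[global] Existing Instance ultra_ultra.

Section Ultrapower.
Variable U : nonprincipal_ultrafilter.
Local Notation inU := (ultra_sets U).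

Section Quotient.
Variable X : choiceType.

Definition ae_eq (f g : nat -> X) : bool := `[< inU [set n | f n = g n] >].

Lemma ae_eq_refl : reflexive ae_eq.
Proof. by move=> f; apply/asboolP; apply: filterE. Qed.

Lemma ae_eq_sym : symmetric ae_eq.
Proof.
by move=> f g; apply/asboolP/asboolP; apply: filterS => n /= ->.
Qed.

Lemma ae_eq_trans : transitive ae_eq.
Proof.
move=> g f h /asboolP fg /asboolP gh; apply/asboolP.
by apply: filterS2 fg gh => n /= -> ->.
Qed.

Canonical ae_eq_equiv := EquivRel ae_eq ae_eq_refl ae_eq_sym ae_eq_trans.

Definition ultrapower := {eq_quot ae_eq_equiv}.

HB.instance Definition _ : EqQuotient _ ae_eq_equiv ultrapower :=
  EqQuotient.on ultrapower.
HB.instance Definition _ := Choice.on ultrapower.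

Definition hclass (f : nat -> X) : ultrapower := \pi_ultrapower f.

Definition std (x : X) : ultrapower := hclass (fun=> x).

Lemma hclassK (x : ultrapower) : hclass (repr x) = x.
Proof. exact: reprK. Qed.

Lemma hclass_eq (f g : nat -> X) :
  hclass f = hclass g <-> inU [set n | f n = g n].
Proof.
rewrite /hclass; split; first by move/eqP; rewrite eqmodE => /asboolP.
by move=> fg; apply/eqP; rewrite eqmodE; apply/asboolP.
Qed.

Lemma repr_hclass (f : nat -> X) : inU [set n | repr (hclass f) n = f n].
Proof. by apply/hclass_eq; rewrite hclassK. Qed.

End Quotient.

(* Componentwise extensions; they are evaluated on representatives, and the
   lemmas below show that the choice of representatives is immaterial. *)
Definition hmap (X Y : choiceType) (h : X -> Y) (x : ultrapower X) :
  ultrapower Y := hclass (fun n => h (repr x n)).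

Definition hmap2 (X Y Z : choiceType) (h : X -> Y -> Z)
    (x : ultrapower X) (y : ultrapower Y) : ultrapower Z :=
  hclass (fun n => h (repr x n) (repr y n)).

Definition hrel (X Y : choiceType) (P : X -> Y -> Prop)
    (x : ultrapower X) (y : ultrapower Y) : Prop :=
  inU [set n | P (repr x n) (repr y n)].

Lemma hmapE (X Y : choiceType) (h : X -> Y) (f : nat -> X) :
  hmap h (hclass f) = hclass (h \o f).
Proof.
by apply/hclass_eq; apply: filterS (repr_hclass f) => n /= ->.
Qed.

Lemma hmap2E (X Y Z : choiceType) (h : X -> Y -> Z)
    (f : nat -> X) (g : nat -> Y) :
  hmap2 h (hclass f) (hclass g) = hclass (fun n => h (f n) (g n)).
Proof.
apply/hclass_eq; apply: filterS2 (repr_hclass f) (repr_hclass g).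
by move=> n /= -> ->.
Qed.

Lemma hrelE (X Y : choiceType) (P : X -> Y -> Prop)
    (f : nat -> X) (g : nat -> Y) :
  hrel P (hclass f) (hclass g) <-> inU [set n | P (f n) (g n)].
Proof.
rewrite /hrel; split.
  by apply: filterS3 (repr_hclass f) (repr_hclass g) => n /= -> ->.
by apply: filterS3 (repr_hclass f) (repr_hclass g) => n /= -> ->.
Qed.

Section Hyperreals.
Variable R : realType.
Local Notation hyperreal := (ultrapower R).
Implicit Types (xi eta : hyperreal) (f g : nat -> R) (r : R).

Definition hle xi eta : Prop := hrel (fun a b : R => a <= b) xi eta.
Definition hlt xi eta : Prop := hrel (fun a b : R => a < b) xi eta.
Definition habs xi : hyperreal := hmap (fun a : R => `|a|) xi.
Definition hsub xi eta : hyperreal := hmap2 (fun a b : R => a - b) xi eta.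
(* Only used with [eta] different from 0. *)
Definition hdiv xi eta : hyperreal := hmap2 (fun a b : R => a / b) xi eta.

Definition infinitesimal xi : Prop :=
  forall e : R, 0 < e -> hlt (habs xi) (std e).

Definition finite_hyper xi : Prop := exists M : R, hle (habs xi) (std M).

Definition little_o xi eta : Prop := infinitesimal (hdiv xi eta).

Definition big_O xi eta : Prop := finite_hyper (hdiv xi eta).

Definition much_larger xi eta : Prop :=
  [/\ hle (std 0) xi, hle (std 0) eta & ~ finite_hyper (hdiv xi eta)].

Definition st xi : R := xget 0 [set r | infinitesimal (hsub xi (std r))].

Record scaling_factor := ScalingFactor {
  scaling_val :> hyperreal ;
  scaling_infinite : much_larger scaling_val (std 1)
}.

Lemma infinitesimalE f :
  infinitesimal (hclass f) <-> forall e, 0 < e -> inU [set n | `|f n| < e].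
Proof.
split=> H e e0; have := H e e0; rewrite /hlt /habs hmapE; first by move/hrelE.
by move=> ?; apply/hrelE.
Qed.

Lemma finite_hyperE f :
  finite_hyper (hclass f) <-> exists M, inU [set n | `|f n| <= M].
Proof.
split=> -[M]; first by rewrite /hle /habs hmapE => /hrelE ?; exists M.
by move=> ?; exists M; rewrite /hle /habs hmapE; apply/hrelE.
Qed.

Lemma infinitesimal_subE f r :
  infinitesimal (hsub (hclass f) (std r)) <-> f @ inU --> r.
Proof.
rewrite /hsub hmap2E infinitesimalE; split.
  move=> H; apply/cvgrPdist_lt => e e0.
  by apply: filterS (H e e0) => n /=; rewrite distrC.
move=> /cvgrPdist_lt H e e0.
by apply: filterS (H e e0) => n /=; rewrite distrC.
Qed.

Lemma st_cvg f r : f @ inU --> r -> st (hclass f) = r.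
Proof.
move=> fr; rewrite /st; case: xgetP => [s _ /infinitesimal_subE fs|].
  exact: (cvg_unique _ fs fr).
by move=> /(_ r); case; apply/infinitesimal_subE.
Qed.

Lemma finite_cvg f : finite_hyper (hclass f) -> exists r, f @ inU --> r.
Proof.
move=> /finite_hyperE[M fM].
have cM := @segment_compact R (- M) M.
have fMU : (f @ inU) `[- M, M]%classic.
  by apply: filterS fM => n /=; rewrite ler_norml in_itv.
have [r [_ rcl]] := cM (f @ inU) _ fMU.
exists r => A /= rA.
have [//|nA] := in_ultra_setVsetC (f @^-1` A) (ultra_ultra U).
by have [x [/= nAx Ax]] := rcl (~` A) A nA rA.
Qed.

Lemma finite_st f : finite_hyper (hclass f) -> f @ inU --> st (hclass f).
Proof. by move=> /finite_cvg[r fr]; rewrite (st_cvg fr). Qed.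

End Hyperreals.
End Ultrapower.

Section Cone.
Variables (R : realType) (U : nonprincipal_ultrafilter) (Y : metricType R).
Local Notation inU := (ultra_sets U).
Variable nu : scaling_factor U R.
Implicit Types x y z : ultrapower U Y.

Definition hdist x y : ultrapower U R := hmap2 (@mdist R Y) x y.

Definition scaling_seq : nat -> R := repr (scaling_val nu).

Let inUI (A B : set nat) : inU A -> inU B -> inU (A `&` B).
Proof. exact: filterI. Qed.

Lemma scaling_gt (M : R) : inU [set n | M < scaling_seq n].
Proof.
have [nu0 _ nu1] := scaling_infinite nu.
have [//|nM] := in_ultra_setVsetC [set n | M < scaling_seq n] (ultra_ultra U).
have {}nu0 : inU [set n | 0 <= scaling_seq n].
  by move: nu0; rewrite -(hclassK nu) /std => /hrelE.
exfalso; apply: nu1; rewrite -(hclassK nu) /hdiv /std hmap2E.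
apply/finite_hyperE; exists M.
apply: filterS2 nu0 nM => n /= n0 /negP.
by rewrite -leNgt divr1 ger0_norm.
Qed.

Definition scaled_dist x y n : R := mdist (repr x n) (repr y n) / scaling_seq n.

Lemma hdist_divE x y : hdiv (hdist x y) nu = hclass U (scaled_dist x y).
Proof. by rewrite /hdist /hmap2 -(hclassK nu) /hdiv hmap2E. Qed.

Lemma scaled_dist_ge0 x y : inU [set n | 0 <= scaled_dist x y n].
Proof.
apply: filterS (scaling_gt 0) => n /= n0.
by rewrite divr_ge0 ?mdist_ge0 // ltW.
Qed.

Lemma scaled_dist_sym x y : scaled_dist x y = scaled_dist y x.
Proof. by apply/funext => n; rewrite /scaled_dist metric_sym. Qed.

Lemma scaled_dist_triangle x y z :
  inU [set n | scaled_dist x z n <= scaled_dist x y n + scaled_dist y z n].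
Proof.
apply: filterS (scaling_gt 0) => n /= n0.
by rewrite -mulrDl ler_pM2r ?invr_gt0 // metric_triangle.
Qed.

Definition cone_eq x y : bool := `[< little_o (hdist x y) nu >].

Lemma cone_eqE x y : cone_eq x y <-> scaled_dist x y @ inU --> (0 : R).
Proof.
rewrite /cone_eq /little_o hdist_divE; split.
  move=> /asboolP /infinitesimalE H; apply/cvgrPdist_lt => e e0.
  by apply: filterS (H e e0) => n /=; rewrite sub0r normrN.
move=> /cvgrPdist_lt H; apply/asboolP/infinitesimalE => e e0.
by apply: filterS (H e e0) => n /=; rewrite sub0r normrN.
Qed.

Lemma cone_eq_refl : reflexive cone_eq.
Proof.
move=> x; apply/cone_eqE.
suff -> : scaled_dist x x = fun=> 0 by exact: cvg_cst.
by apply/funext => n; rewrite /scaled_dist mdistxx mul0r.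
Qed.

Lemma cone_eq_sym : symmetric cone_eq.
Proof.
move=> x y; apply/idP/idP => /cone_eqE H; apply/cone_eqE;
  by rewrite scaled_dist_sym.
Qed.

Lemma cone_eq_trans : transitive cone_eq.
Proof.
move=> y x z /cone_eqE xy /cone_eqE yz; apply/cone_eqE.
apply/cvgrPdist_lt => e e0; have e20 : 0 < e / 2 by rewrite divr_gt0.
move/cvgrPdist_lt: xy => /(_ _ e20) xy; move/cvgrPdist_lt: yz => /(_ _ e20) yz.
have xz : inU [set n |
    `|scaled_dist x y n| < e / 2 /\ `|scaled_dist y z n| < e / 2].
  by apply: filterS2 xy yz => n /=; rewrite !sub0r !normrN.
apply: filterS3 xz (scaled_dist_triangle x y z) (scaled_dist_ge0 x z).
move=> n /= [xy' yz'] tr /ger0_norm ge0; rewrite sub0r normrN ge0 (splitr e).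
apply: (le_lt_trans tr); apply: ltrD.
  exact: le_lt_trans (ler_norm _) xy'.
exact: le_lt_trans (ler_norm _) yz'.
Qed.

Canonical cone_equiv := EquivRel cone_eq cone_eq_refl cone_eq_sym cone_eq_trans.

Definition cone_quotient := {eq_quot cone_equiv}.

HB.instance Definition _ : EqQuotient _ cone_equiv cone_quotient :=
  EqQuotient.on cone_quotient.
HB.instance Definition _ := Choice.on cone_quotient.

Variable p : ultrapower U Y.

Definition in_cone (c : cone_quotient) : bool :=
  `[< big_O (hdist (repr c) p) nu >].

Definition cone : Type := {c : cone_quotient | in_cone c}.

HB.instance Definition _ := Choice.on cone.

Definition cone_dist (a b : cone) : R :=
  st (hdiv (hdist (repr (val a)) (repr (val b))) nu).

Lemma big_OE x :
  big_O (hdist x p) nu <-> exists M, inU [set n | scaled_dist x p n <= M].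
Proof.
rewrite /big_O hdist_divE finite_hyperE; split=> -[M xM]; exists M.
  by apply: filterS xM => n /=; apply: le_trans (ler_norm _).
by apply: filterS2 (scaled_dist_ge0 x p) xM => n /= /ger0_norm ->.
Qed.

Lemma scaled_dist_cvg (a b : cone) :
  scaled_dist (repr (val a)) (repr (val b)) @ inU --> cone_dist a b.
Proof.
rewrite /cone_dist hdist_divE; apply: finite_st; apply/finite_hyperE.
have /asboolP/big_OE[M aM] := valP a; have /asboolP/big_OE[N bN] := valP b.
exists (M + N); have abMN := inUI aM bN.
have ab0 := scaled_dist_ge0 (repr (val a)) (repr (val b)).
have abt := scaled_dist_triangle (repr (val a)) p (repr (val b)).
apply: filterS3 ab0 abt abMN.
move=> n /= /ger0_norm -> tr [an bn]; apply: (le_trans tr); apply: lerD => //.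
by rewrite scaled_dist_sym.
Qed.

Lemma cone_distxx a : cone_dist a a = 0.
Proof.
have /cone_eqE H := cone_eq_refl (repr (val a)).
exact: (cvg_unique (@Rhausdorff R) (@scaled_dist_cvg a a) H).
Qed.

Lemma cone_dist_eq0 a b : cone_dist a b = 0 -> a = b.
Proof.
move=> ab; have := @scaled_dist_cvg a b; rewrite ab => /cone_eqE /= H.
apply: val_inj; rewrite -[LHS]reprK -[RHS]reprK.
by apply/eqP; rewrite eqmodE.
Qed.

Lemma cone_dist_sym a b : cone_dist a b = cone_dist b a.
Proof. by rewrite /cone_dist !hdist_divE scaled_dist_sym. Qed.

Lemma cone_dist_triangle b a c :
  cone_dist a c <= cone_dist a b + cone_dist b c.
Proof.
apply: (ler_cvg_to (@scaled_dist_cvg a c)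
  (cvgD (@scaled_dist_cvg a b) (@scaled_dist_cvg b c))).
exact: scaled_dist_triangle.
Qed.

HB.instance Definition _ := isMetric.Build R cone
  cone_distxx cone_dist_eq0 cone_dist_sym cone_dist_triangle.

(* Neither membership nor the distance depends on the representatives. *)
Lemma in_coneE x : in_cone (\pi_cone_quotient x) <-> big_O (hdist x p) nu.
Proof.
have /cone_eqE/cvgrPdist_lt/(_ 1 ltr01) : cone_eq (repr (\pi_cone_quotient x)) x.
  by have /eqP := reprK (\pi_cone_quotient x); rewrite eqmodE.
set y := repr _ => yx; rewrite /in_cone -/y.
have {}yx : inU [set n | scaled_dist y x n < 1].
  by apply: filterS yx => n /=; rewrite sub0r normrN; apply: le_lt_trans (ler_norm _).
split=> [/asboolP|] /big_OE[M xM]; [|apply/asboolP]; apply/big_OE; exists (1 + M).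
  apply: filterS3 yx xM (scaled_dist_triangle x y p) => n /=.
  by rewrite (scaled_dist_sym x y); lra.
by apply: filterS3 yx xM (scaled_dist_triangle y x p) => n /=; lra.
Qed.

Lemma cone_distE (a b : cone) x y :
  val a = \pi_cone_quotient x -> val b = \pi_cone_quotient y ->
  mdist a b = st (hdiv (hdist x y) nu).
Proof.
move=> ax bj; rewrite hdist_divE; apply/esym/st_cvg.
have near0 (c : cone) z : val c = \pi_cone_quotient z ->
    scaled_dist (repr (val c)) z @ inU --> (0 : R).
  by move=> cz; apply/cone_eqE; have /eqP := reprK (val c);
    rewrite {2}cz eqmodE.
have ax0 := @near0 a x ax; have by0 := @near0 b y bj.
have lo := cvgB (cvgB (@scaled_dist_cvg a b) ax0) by0.
have hi := cvgD (cvgD ax0 (@scaled_dist_cvg a b)) by0.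
rewrite !subr0 in lo; rewrite add0r addr0 in hi.
have lohi : inU [set n |
    scaled_dist (repr (val a)) (repr (val b)) n - scaled_dist (repr (val a)) x n
      - scaled_dist (repr (val b)) y n <= scaled_dist x y n <=
    scaled_dist (repr (val a)) x n + scaled_dist (repr (val a)) (repr (val b)) n
      + scaled_dist (repr (val b)) y n].
  have t1 := scaled_dist_triangle (repr (val a)) x (repr (val b)).
  have t2 := scaled_dist_triangle x y (repr (val b)).
  have t3 := scaled_dist_triangle x (repr (val a)) y.
  have t4 := scaled_dist_triangle (repr (val a)) (repr (val b)) y.
  have t12 := inUI t1 t2.
  apply: filterS3 t12 t3 t4 => n /= [].
  rewrite (scaled_dist_sym x (repr (val a))) (scaled_dist_sym y (repr (val b))).
  move: (scaled_dist _ _ _) => q1; lra.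
exact: (squeeze_cvgr lohi (lo _ _) (hi _ _)).
Qed.

End Cone.

Record connected_graph := ConnectedGraph {
  vertices : choiceType ;
  adj : vertices -> vertices -> Prop ;
  adj_sym : forall v w, adj v w -> adj w v ;
  adj_connected : forall (A : set vertices) v,
    A v -> (forall u w, A u -> adj u w -> A w) -> A = setT
}.

(* Geometric realization of a graph: each edge {v, w} is a copy of the unit
   interval, loops included. An interior point of {v, w} has two names,
   [edge_pt v w t] and [edge_pt w v (1 - t)], when v and w are distinct; these
   are at path distance 0, and get identified when passing to the metric
   quotient. *)
Section GeometricRealization.
Variables (R : realType) (Gr : connected_graph).
Local Notation V := (vertices Gr).

Inductive graph_pt : Type :=
| vertex_pt (v : V)
| edge_pt (v w : V) (t : R) of adj v w & 0 < t < 1.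

(* [on_edge v w x t]: x is the point at distance t from v along {v, w}. *)
Inductive on_edge (v w : V) : graph_pt -> R -> Prop :=
| on_edge_source : on_edge v w (vertex_pt v) 0
| on_edge_target : on_edge v w (vertex_pt w) 1
| on_edge_inner t e t01 : on_edge v w (@edge_pt v w t e t01) t
| on_edge_flip t e t01 : v <> w -> on_edge v w (@edge_pt w v t e t01) (1 - t).

Inductive edge_segment (x y : graph_pt) : R -> Prop :=
| EdgeSegment v w s t of adj v w & on_edge v w x s & on_edge v w y t :
    edge_segment x y `|s - t|.

(* Lengths of the paths from x to y that are concatenations of segments. *)
Inductive path_length : graph_pt -> graph_pt -> R -> Prop :=
| path_length_nil x : path_length x x 0
| path_length_cons x y z k l : edge_segment x y k -> path_length y z l ->
    path_length x z (k + l).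

Definition path_dist (x y : graph_pt) : R := inf [set l | path_length x y l].

Lemma edge_segment_sym x y k : edge_segment x y k -> edge_segment y x k.
Proof. by case=> v w s t e xs yt; rewrite distrC; apply: EdgeSegment e yt xs. Qed.

Lemma path_length_ge0 x y l : path_length x y l -> 0 <= l.
Proof.
elim=> // {}x {}y z k {}l [v w s t _ _ _] _ l0.
by rewrite addr_ge0.
Qed.

Lemma path_length_cat x y z k l :
  path_length x y k -> path_length y z l -> path_length x z (k + l).
Proof.
elim=> [{}x|{}x {}y y' h {}k xy yy' IH] yz; first by rewrite add0r.
by rewrite -addrA; apply: path_length_cons xy _; apply: IH.
Qed.

Lemma path_length_seg x y k : edge_segment x y k -> path_length x y k.
Proof.
by move=> xy; rewrite -[k]addr0; apply: path_length_cons xy (path_length_nil y).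
Qed.

Lemma path_length_sym x y l : path_length x y l -> path_length y x l.
Proof.
elim=> [{}x|{}x {}y z k {}l xy _ zy]; first exact: path_length_nil.
rewrite addrC; apply: path_length_cat zy _.
exact/path_length_seg/edge_segment_sym.
Qed.

Lemma path_length_ex x y : [set l | path_length x y l] !=set0.
Proof.
have toV z : exists v l, path_length z (vertex_pt v) l.
  case: z => [v|v w t e t01]; first by exists v, 0; exact: path_length_nil.
  exists v, `|t - 0|; apply: path_length_seg.
  by apply: (EdgeSegment e); [exact: on_edge_inner | exact: on_edge_source].
have [v [k xv]] := toV x; have [w [l yw]] := toV y.
have : [set u | exists m, path_length (vertex_pt v) (vertex_pt u) m] = setT.
  apply: (adj_connected (v := v)) => [|u u' [m vu] e].
    by exists 0; exact: path_length_nil.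
  exists (m + `|0 - 1|); apply: path_length_cat vu _; apply: path_length_seg.
  by apply: (EdgeSegment e); [exact: on_edge_source | exact: on_edge_target].
move/seteqP => -[_ /(_ w I) [m vw]].
exists (k + m + l); apply: path_length_cat (path_length_sym yw).
exact: path_length_cat xv vw.
Qed.

Lemma path_length_lb x y : lbound [set l | path_length x y l] 0.
Proof. by move=> l /path_length_ge0. Qed.

Lemma path_dist_le x y l : path_length x y l -> path_dist x y <= l.
Proof. by move=> xy; apply: ge_inf => //; exists 0; exact: path_length_lb. Qed.

Lemma path_dist_ge0 x y : 0 <= path_dist x y.
Proof. by apply: lb_le_inf; [exact: path_length_ex|exact: path_length_lb]. Qed.

Lemma path_distxx x : path_dist x x = 0.
Proof.
apply/le_anti; rewrite path_dist_ge0 andbT.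
exact/path_dist_le/path_length_nil.
Qed.

Lemma path_dist_sym x y : path_dist x y = path_dist y x.
Proof.
by congr (inf _); apply/seteqP; split=> l /= /path_length_sym.
Qed.

Lemma path_dist_triangle y x z :
  path_dist x z <= path_dist x y + path_dist y z.
Proof.
rewrite -lerBlDr; apply: lb_le_inf; first exact: path_length_ex.
move=> k /= xy; rewrite lerBlDr -lerBlDl.
apply: lb_le_inf; first exact: path_length_ex.
move=> l /= yz; rewrite lerBlDl.
exact/path_dist_le/(path_length_cat xy yz).
Qed.

Definition same_pt (x y : {classic graph_pt}) : bool := path_dist x y == 0.

Lemma same_pt_refl : reflexive same_pt.
Proof. by move=> x; apply/eqP/path_distxx. Qed.

Lemma same_pt_sym : symmetric same_pt.
Proof. by move=> x y; rewrite /same_pt path_dist_sym. Qed.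

Lemma same_pt_trans : transitive same_pt.
Proof.
move=> y x z /eqP xy /eqP yz; apply/eqP/le_anti; rewrite path_dist_ge0 andbT.
by apply: le_trans (path_dist_triangle y x z) _; rewrite xy yz addr0.
Qed.

Canonical same_pt_equiv :=
  EquivRel same_pt same_pt_refl same_pt_sym same_pt_trans.

Definition metric_graph := {eq_quot same_pt_equiv}.

HB.instance Definition _ : EqQuotient _ same_pt_equiv metric_graph :=
  EqQuotient.on metric_graph.
HB.instance Definition _ := Choice.on metric_graph.

Definition graph_dist (x y : metric_graph) : R := path_dist (repr x) (repr y).

Lemma graph_distxx x : graph_dist x x = 0.
Proof. exact: path_distxx. Qed.

Lemma graph_dist_eq0 x y : graph_dist x y = 0 -> x = y.
Proof.
move=> xy; rewrite -[LHS]reprK -[RHS]reprK.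
by apply/eqP; rewrite eqmodE; apply/eqP.
Qed.

Lemma graph_dist_sym x y : graph_dist x y = graph_dist y x.
Proof. exact: path_dist_sym. Qed.

Lemma graph_dist_triangle y x z :
  graph_dist x z <= graph_dist x y + graph_dist y z.
Proof. exact: path_dist_triangle. Qed.

HB.instance Definition _ := isMetric.Build R metric_graph
  graph_distxx graph_dist_eq0 graph_dist_sym graph_dist_triangle.

Definition vertex (v : V) : metric_graph := \pi_metric_graph (vertex_pt v).

Lemma graph_distE (x y : {classic graph_pt}) :
  mdist (\pi_metric_graph x) (\pi_metric_graph y) = path_dist x y.
Proof.
have r0 (z : {classic graph_pt}) : path_dist (repr (\pi_metric_graph z)) z = 0.
  apply/eqP; rewrite -/(same_pt _ _).
  by have /eqP := reprK (\pi_metric_graph z); rewrite eqmodE.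
apply/le_anti/andP; split.
  have := path_dist_triangle x
    (repr (\pi_metric_graph x)) (repr (\pi_metric_graph y)).
  have := path_dist_triangle y x (repr (\pi_metric_graph y)).
  rewrite (path_dist_sym y (repr _)) !r0 addr0 add0r => h1 h2.
  exact: le_trans h2 h1.
have := path_dist_triangle (repr (\pi_metric_graph x)) x y.
have := path_dist_triangle (repr (\pi_metric_graph y))
  (repr (\pi_metric_graph x)) y.
rewrite (path_dist_sym x (repr _)) !r0 addr0 add0r => h1 h2.
exact: le_trans h2 h1.
Qed.

End GeometricRealization.

Local Open Scope group_scope.

Definition generates (G : groupType) (S : set G) : Prop :=
  forall H : set G, H 1 -> (forall x y, H x -> H y -> H (x * y)) ->
    (forall x, H x -> H x^-1) -> S `<=` H -> H = setT.

(* A group G with such an S is finitely generated. *)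
Record finite_symmetric_generating_set (G : groupType) := FinSymGenSet {
  generators : set G ;
  generators_finite : finite_set generators ;
  generators_symmetric : [set s^-1 | s in generators] = generators ;
  generators_generate : generates generators
}.

Section Cayley.
Variables (G : groupType) (S : finite_symmetric_generating_set G).

Definition cayley_adj (g h : G) : Prop := exists2 s, generators S s & g * s = h.

Lemma generatorsV s : generators S s -> generators S s^-1.
Proof. by move=> Ss; rewrite -(generators_symmetric S); exists s. Qed.

Lemma cayley_adj_sym g h : cayley_adj g h -> cayley_adj h g.
Proof.
move=> [s Ss <-]; exists s^-1; first exact: generatorsV.
by rewrite -mulgA mulgV mulg1.
Qed.

Lemma cayley_adj_connected (A : set G) g :
  A g -> (forall u w, A u -> cayley_adj u w -> A w) -> A = setT.
Proof.
move=> Ag Aadj.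
pose H := [set h : G | forall a, A a <-> A (a * h)].
have HT : H = setT.
  apply: (generators_generate (f := S)).
  - by move=> a; rewrite mulg1.
  - by move=> x y Hx Hy a; rewrite mulgA; apply: iff_trans (Hx a) (Hy _).
  - move=> x Hx a; have := Hx (a * x^-1).
    by rewrite -mulgA mulVg mulg1 => ax; split=> [/ax|/ax].
  - move=> s Ss a; split=> As; first by apply: Aadj As _; exists s.
    apply: Aadj As _; exists s^-1; first exact: generatorsV.
    by rewrite -mulgA mulgV mulg1.
apply/seteqP; split=> // h _.
have : H (g^-1 * h) by rewrite HT.
by move=> /(_ g) []; rewrite mulgA mulgV mul1g => /(_ Ag).
Qed.

Definition cayley_graph : connected_graph :=
  ConnectedGraph cayley_adj_sym cayley_adj_connected.

End Cayley.

Local Close Scope group_scope.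

Definition cayley_space (R : realType) (G : groupType)
    (S : finite_symmetric_generating_set G) : metricType R :=
  metric_graph R (cayley_graph S).

Definition cayley_vertex (R : realType) (G : groupType)
    (S : finite_symmetric_generating_set G) (g : G) : cayley_space R S :=
  @vertex R (cayley_graph S) g.

Definition group_cone (R : realType) (U : nonprincipal_ultrafilter)
    (G : groupType) (S : finite_symmetric_generating_set G)
    (g : ultrapower U G) (nu : scaling_factor U R) : metricType R :=
  @cone R U (cayley_space R S) nu (hmap (@cayley_vertex R G S) g).

Definition isometric (R : realType) (X Y : metricType R) : Prop :=
  exists f : X -> Y, (forall x y, mdist (f x) (f y) = mdist x y) /\
    (forall y, exists x, f x = y).

Section RealTrees.
Variables (R : realType) (X : metricType R).

Definition geodesic (l : R) (gamma : R -> X) : Prop :=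
  0 <= l /\ {in `[0, l] &, forall s t, mdist (gamma t) (gamma s) = `|t - s|}.

Definition geodesic_between (x y : X) (l : R) (gamma : R -> X) : Prop :=
  [/\ geodesic l gamma, gamma 0 = x & gamma l = y].

Definition geodesic_image (l : R) (gamma : R -> X) : set X :=
  gamma @` [set` `[0, l]].

Definition geodesic_space : Prop :=
  forall x y : X, exists l gamma, geodesic_between x y l gamma.

Definition complete_space : Prop :=
  forall F : set_system X, ProperFilter F -> cauchy F ->
    exists x : X, F --> x.

Definition tripod_triangles : Prop :=
  forall (x y z : X) (l1 l2 l3 : R) (g1 g2 g3 : R -> X),
    geodesic_between x y l1 g1 -> geodesic_between y z l2 g2 ->
    geodesic_between z x l3 g3 ->
    [/\ geodesic_image l1 g1 `<=` geodesic_image l2 g2 `|` geodesic_image l3 g3,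
        geodesic_image l2 g2 `<=` geodesic_image l3 g3 `|` geodesic_image l1 g1 &
        geodesic_image l3 g3 `<=` geodesic_image l1 g1 `|` geodesic_image l2 g2].

Definition real_tree : Prop :=
  [/\ complete_space, geodesic_space & tripod_triangles].

(* The valency of X at p is the cardinality of this set. *)
Definition branches (p : X) : set (set X) :=
  [set connected_component (~` [set p]) x | x in ~` [set p]].

Definition is_point : Prop := exists x : X, forall y, y = x.

End RealTrees.

(* Main.v *)
(* Left multiplication makes an asymptotic cone of a group homogeneous, and a
   real tree is 0-hyperbolic for the Gromov product; x and y are in different
   components of X \ {p} as soon as their Gromov product at p vanishes. If X has
   two points then, by homogeneity, every point is the midpoint of segments of
   any length. If no point of X is the centre of a tripod, the signed distance
   to a point is an isometry onto the line. Otherwise every point is such a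
   centre, so infinitely many branches leave any short segment [p, b], and their
   endpoints at distance 1 from p have pairwise Gromov products at most
   d(p, b). Sending d(p, b) to 0 with a diagonal choice along the ultrafilter
   turns these families into 2^aleph_0 points at distance 1 from p with pairwise
   Gromov products 0. Conversely a cone point is given by a sequence of elements
   of a countable group, hence there are at most 2^aleph_0 components. *)
Require Import Defs.
From mathcomp Require Import all_boot all_order all_algebra.
From mathcomp Require Import all_classical all_reals.
From mathcomp Require Import topology normedtype.
From mathcomp Require Import lra.

Set Implicit Arguments.
Unset Strict Implicit.
Unset Printing Implicit Defensive.

Import Order.TTheory GRing.Theory Num.Theory.
Import numFieldNormedType.Exports.

Local Open Scope classical_set_scope.
Local Open Scope ring_scope.

(** * Gromov products and 0-hyperbolicity of real trees *)

Section GromovProduct.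
Variables (R : realType) (X : metricType R).
Implicit Types p q x y z : X.

Definition gromov_product p x y : R := (mdist p x + mdist p y - mdist x y) / 2.

Definition zero_hyperbolic : Prop := forall p x y z,
  Num.min (gromov_product p x y) (gromov_product p y z) <= gromov_product p x z.

Definition homogeneous : Prop := forall p q, exists f : X -> X,
  (forall x y, mdist (f x) (f y) = mdist x y) /\ f p = q.

Lemma gromov_productC p x y : gromov_product p x y = gromov_product p y x.
Proof. by rewrite /gromov_product (metric_sym x y); lra. Qed.

Lemma gromov_product_ge0 p x y : 0 <= gromov_product p x y.
Proof.
by have := metric_triangle x p y; rewrite /gromov_product (metric_sym x p); lra.
Qed.

Lemma gromov_product_lel p x y : gromov_product p x y <= mdist p x.
Proof.
by have := metric_triangle p x y; rewrite /gromov_product; lra.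
Qed.

Lemma gromov_productxx p x : gromov_product p x x = mdist p x.
Proof. by rewrite /gromov_product mdistxx; lra. Qed.

Lemma geodesic_dist (l s t : R) (c : R -> X) : geodesic l c ->
  0 <= s <= t -> t <= l -> mdist (c s) (c t) = t - s.
Proof.
move=> [l0 cg] /andP[s0 st] tl; rewrite cg ?in_itv /=; last 2 first.
- by rewrite (le_trans s0 st) tl.
- by rewrite s0 (le_trans st tl).
by rewrite distrC ger0_norm; lra.
Qed.

Lemma geodesic_between_length x y l c : geodesic_between x y l c -> l = mdist x y.
Proof.
move=> [[l0 cg] <- <-]; have lx : (0 <= l <= l) by rewrite l0 lexx.
by rewrite (geodesic_dist (conj l0 cg)) ?lexx ?l0 ?subr0.
Qed.

Lemma geodesic_rev x y l c : geodesic_between x y l c ->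
  geodesic_between y x l (fun t => c (l - t)).
Proof.
move=> [[l0 cg] <- <-]; split; rewrite ?subr0 ?subrr //; split=> // s t.
rewrite !in_itv /= => /andP[s0 sl] /andP[t0 tl].
rewrite cg ?in_itv /=; [|lra|lra].
by rewrite distrC; congr `|_|; lra.
Qed.

(* The two geodesics issuing from [p] coincide up to their Gromov product, by
   the tripod condition. *)
Lemma geodesics_agree p x y (l1 : R) c1 (l2 : R) c2 (t : R) :
  geodesic_space X -> tripod_triangles X ->
  geodesic_between p x l1 c1 -> geodesic_between p y l2 c2 ->
  0 <= t -> t < gromov_product p x y -> c1 t = c2 t.
Proof.
move=> geo tri g1 g2 t0 tlt.
have [l3 [c3 g3]] := geo x y.
have l1E := geodesic_between_length g1; have l2E := geodesic_between_length g2.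
have l3E := geodesic_between_length g3.
have tx := gromov_product_lel p x y.
have ty := gromov_product_lel p y x; rewrite gromov_productC in ty.
have [+ _ _] := tri _ _ _ _ _ _ _ _ _ g1 g3 (geodesic_rev g2).
have [g1g c10 c1l] := g1; have [g2g c20 c2l] := g2; have [g3g c30 c3l] := g3.
have c1t : geodesic_image l1 c1 (c1 t).
  by exists t => //=; rewrite in_itv /=; lra.
have d1 : mdist p (c1 t) = t by rewrite -c10 (geodesic_dist g1g) ?subr0 //; lra.
have d2 : mdist (c1 t) x = l1 - t by rewrite -c1l (geodesic_dist g1g) //; lra.
(* On the side from [x] to [y], the detour from [p] to [y] through [c1 t] would force
   [gromov_product p x y <= t]; on the other side, the distance to [p] fixes the parameter. *)
move=> /(_ _ c1t) [] [s /=]; rewrite in_itv /= => /andP[s0 sl].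
  move=> cs.
  have d3 : mdist x (c1 t) = s.
    by rewrite -cs -c30 (geodesic_dist g3g) ?subr0 //; lra.
  have d4 : mdist (c1 t) y = l3 - s.
    by rewrite -cs -c3l (geodesic_dist g3g) //; lra.
  exfalso; have := metric_triangle p (c1 t) y.
  by rewrite (metric_sym (c1 t) x) in d2; move: tlt; rewrite /gromov_product; lra.
move=> cs.
have tE : t = l2 - s.
  by rewrite -[LHS]d1 -cs -c20 (geodesic_dist g2g) ?subr0 //; lra.
by rewrite -[LHS]cs -tE.
Qed.

(** Otherwise take [t] strictly between the two sides: the geodesics from [p] to [x], [y] and [z]
    share their point at distance [t], and going from [x] to [z] through it is shorter than
    [mdist x z]. *)
Lemma real_tree_zero_hyperbolic : real_tree X -> zero_hyperbolic.
Proof.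
move=> [_ geo tri] p x y z; rewrite leNgt; apply/negP => lt.
have [l1 [c1 g1]] := geo p x; have [l2 [c2 g2]] := geo p y.
have [l3 [c3 g3]] := geo p z.
pose m := Num.min (gromov_product p x y) (gromov_product p y z).
pose t := (m + gromov_product p x z) / 2.
have xz0 := gromov_product_ge0 p x z.
have tm : t < m by rewrite /t; move: lt; rewrite -/m; lra.
have t0 : 0 <= t by rewrite /t; move: lt; rewrite -/m; lra.
have txz : gromov_product p x z < t by rewrite /t; move: lt; rewrite -/m; lra.
move: tm; rewrite lt_min => /andP[txy tyz].
have cE := geodesics_agree geo tri g1 g2 t0 txy.
rewrite (geodesics_agree geo tri g2 g3 t0 tyz) in cE.
have l1E := geodesic_between_length g1; have l3E := geodesic_between_length g3.
have tx := gromov_product_lel p x y.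
have tz := gromov_product_lel p z y; rewrite gromov_productC in tz.
have [g1g c10 c1l] := g1; have [g3g c30 c3l] := g3.
have d1 : mdist (c1 t) x = l1 - t by rewrite -c1l (geodesic_dist g1g) //; lra.
have d3 : mdist (c1 t) z = l3 - t by rewrite cE -c3l (geodesic_dist g3g) //; lra.
have := metric_triangle x (c1 t) z; rewrite (metric_sym x (c1 t)) d1 d3.
by move: txz; rewrite /gromov_product; lra.
Qed.

Lemma geodesic_point p x (t : R) : geodesic_space X -> 0 <= t <= mdist p x ->
  exists2 c, mdist p c = t & mdist c x = mdist p x - t.
Proof.
move=> geo tpx; have [l [c g]] := geo p x.
have lE := geodesic_between_length g; have [gg c0 cl] := g.
exists (c t); rewrite -?lE.
  by rewrite -c0 (geodesic_dist gg) ?subr0 //; lra.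
by rewrite -{1}cl (geodesic_dist gg) //; lra.
Qed.

Lemma gromov_product_trans p x y z (m : R) : zero_hyperbolic ->
  m < gromov_product p x y -> m < gromov_product p y z ->
  m < gromov_product p x z.
Proof.
by move=> hyp xy yz; apply: lt_le_trans (hyp p x y z); rewrite lt_min xy.
Qed.

Lemma gromov_product_isometry (f : X -> X) p x y :
  (forall x y, mdist (f x) (f y) = mdist x y) ->
  gromov_product (f p) (f x) (f y) = gromov_product p x y.
Proof. by move=> fE; rewrite /gromov_product !fE. Qed.

End GromovProduct.

(** * Homogeneous 0-hyperbolic geodesic spaces: lines and tripods *)

Section HomogeneousTree.
Variables (R : realType) (X : metricType R).
Hypotheses (geo : geodesic_space X) (hyp : zero_hyperbolic X)
  (hom : homogeneous X).
Implicit Types p q x y z : X.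
Local Notation gp := gromov_product.

(** A zero Gromov product says that distances add up through [p], so [p] is the midpoint of [x] and
    [y]. *)
Definition opposite (L : R) (p x y : X) : Prop :=
  [/\ mdist p x = L, mdist p y = L & gp p x y = 0].

Definition tripod_at (p x y z : X) : Prop :=
  [/\ [/\ p != x, p != y & p != z], gp p x y = 0, gp p y z = 0 & gp p x z = 0].

Lemma exists_opposite (L : R) (a b p : X) : 0 <= L -> mdist a b = L + L ->
  exists x y, opposite L p x y.
Proof.
move=> L0 ab; have [|c ac cb] := @geodesic_point _ _ a b L geo; first by lra.
have [f [fE fc]] := hom c p; exists (f a), (f b).
rewrite /opposite -fc gromov_product_isometry // !fE metric_sym ac cb.
by rewrite /gp (metric_sym c) ac cb ab; split; lra.
Qed.

(* At most one of two opposite directions leads back towards [x]. *)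
Lemma opposite_escape (L : R) (p u v x : X) : opposite L p u v ->
  exists w, mdist p w = L /\ gp p x w = 0.
Proof.
move=> [pu pv uv]; have [xu|xu] := leP (gp p x u) 0.
  by exists u; split=> //; apply/le_anti; rewrite xu gromov_product_ge0.
exists v; split=> //; apply/le_anti; rewrite gromov_product_ge0 andbT leNgt.
apply/negP => xv; rewrite gromov_productC in xu.
by have := gromov_product_trans hyp xu xv; rewrite uv ltxx.
Qed.

(** Starting at [a], segments of length [mdist a b / 2] are appended one by one, each in a direction
    leading away from [a]. *)
Lemma unbounded (a b : X) (n : nat) : a != b ->
  exists x, mdist a x = mdist a b / 2 *+ n.
Proof.
rewrite -mdist_gt0 => ab; elim: n => [|n [x ax]].
  by exists a; rewrite mdistxx mulr0n.
have [||u [v uv]] := @exists_opposite (mdist a b / 2) a b x; [lra..|].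
have [w [xw gw]] := opposite_escape a uv; exists w.
by move: gw; rewrite /gp (metric_sym x) ax xw (mulrSr _ n); lra.
Qed.

Lemma opposite_ex (a b : X) (L : R) (p : X) : a != b -> 0 <= L ->
  exists x y, opposite L p x y.
Proof.
move=> ab L0; have := ab; rewrite -mdist_gt0 => ab0.
(* Enough steps to reach distance [L + L] from [a]; the midpoint of a segment of that length is then
   carried to [p]. *)
pose n := Num.bound ((L + L) / (mdist a b / 2)).
have [x ax] := unbounded n ab.
have Lx : L + L <= mdist a x.
  rewrite ax -mulr_natl -ler_pdivrMr; last by lra.
  by apply/ltW/archi_boundP; rewrite divr_ge0; lra.
have [|y ay _] := @geodesic_point _ _ a x (L + L) geo; first by lra.
exact: exists_opposite ay.
Qed.


Lemma escape (a b : X) (L : R) (p x : X) : a != b -> 0 <= L ->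
  exists w, mdist p w = L /\ gp p x w = 0.
Proof.
by move=> ab L0; have [u [v uv]] := opposite_ex p ab L0; apply: opposite_escape uv.
Qed.

(* The branch point of [x] and [y] seen from [p]. *)
Lemma gromov_point p x y : exists c,
  [/\ mdist p c = gp p x y, mdist c x = mdist p x - gp p x y &
      mdist c y = mdist p y - gp p x y].
Proof.
have g0 := gromov_product_ge0 p x y; have gx := gromov_product_lel p x y.
have gy := gromov_product_lel p y x; rewrite gromov_productC in gy.
have [|c pc cx] := @geodesic_point _ _ p x (gp p x y) geo; first by rewrite g0.
exists c; split=> //; have cxE : gp p c x = gp p x y.
  by rewrite /gp pc cx /gp; lra.
(* 0-hyperbolicity bounds [gp p c y] below, hence [mdist c y] above; the triangle inequality gives
   the other bound. *)
have := hyp p c x y; rewrite cxE minxx.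
have := metric_triangle p c y; rewrite pc {3}/gp pc => h1 h2.
by apply/le_anti; apply/andP; split; lra.
Qed.

(** The branch point of [x] and [y] differs from [p]; unless it is [x] or [y], it is the centre of a
    tripod. So one of [x], [y] lies between [p] and the other. *)
Lemma same_side_dist p x y : (forall q u v w, ~ tripod_at q u v w) ->
  0 < gp p x y -> mdist x y = `|mdist p x - mdist p y|.
Proof.
move=> notri g0; have [c [pc cx cy]] := gromov_point p x y.
have gx := gromov_product_lel p x y.
have gy := gromov_product_lel p y x; rewrite gromov_productC in gy.
have [xE|xN] := eqVneq c x; last have [yE|yN] := eqVneq c y.
- move: cx; rewrite xE mdistxx => cx.
  by rewrite distrC ger0_norm; move: cx gy; rewrite /gp; lra.
- move: cy; rewrite yE mdistxx => cy.
  by rewrite ger0_norm; move: cy gx; rewrite /gp; lra.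
case: (notri c p x y); split; first split=> //.
- by rewrite -mdist_gt0 metric_sym pc.
- by rewrite /gp (metric_sym c p) pc cx /gp; lra.
- by rewrite /gp cx cy /gp; lra.
- by rewrite /gp (metric_sym c p) pc cy /gp; lra.
Qed.

Lemma no_tripod_line (a b : X) : a != b -> (forall p x y z, ~ tripod_at p x y z) ->
  isometric X R^o.
Proof.
move=> ab notri.
(* The sign is positive exactly on the side of [a] that contains [b]. *)
pose f (x : X) : R^o := if 0 < gp a b x then mdist a x else - mdist a x.
have fE x y : mdist (f x) (f y) = mdist x y.
  have opp u v : 0 < gp a b u -> ~~ (0 < gp a b v) ->
      mdist u v = mdist a u + mdist a v.
    move=> bu; rewrite -leNgt => bv.
    have : ~~ (0 < gp a u v).
      by apply/negP => uv; have := gromov_product_trans hyp bu uv; rewrite ltNge bv.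
    by have := gromov_product_ge0 a u v; rewrite -leNgt /gp; lra.
  have dE (s t : R^o) : mdist s t = `|(t : R) - s| by [].
  have d0 := mdist_ge0 a x; have d1 := mdist_ge0 a y.
  rewrite dE /f; case: ifPn => yb; case: ifPn => xb.
  - rewrite (@same_side_dist a x y notri) 1?distrC //.
    by apply: gromov_product_trans hyp _ yb; rewrite gromov_productC.
  - by rewrite (metric_sym x y) (opp y x) // ger0_norm; lra.
  - by rewrite (opp x y) // ler0_norm; lra.
  (* Neither point is on the side of [b]. If their product vanishes as well, [b], [x], [y] form a
     tripod at [a] unless [x] or [y] is [a]. *)
  - have [xy0|xy0] := ltP 0 (gp a x y).
      by rewrite (same_side_dist notri xy0) opprK addrC.
    have xa : a = x \/ a = y.
      have [|xN] := eqVneq a x; first by left.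
      have [|yN] := eqVneq a y; first by right.
      have z u v : ~~ (0 < gp a u v) -> gp a u v = 0.
        by rewrite -leNgt => uv; apply/le_anti; rewrite uv gromov_product_ge0.
      by case: (notri a b x y); split => //; apply: z => //; rewrite -leNgt.
    case: xa => <-; rewrite mdistxx oppr0.
      by rewrite subr0 normrN ger0_norm.
    by rewrite sub0r opprK (metric_sym x a) ger0_norm.
exists f; split=> // r.
(* The values at [u] and [v] have modulus [|r|] and are [2|r|] apart, so one of them is [r]. *)
have [u [v [au av uv]]] := opposite_ex a ab (normr_ge0 r).
have := fE u v; have -> : mdist (f u) (f v) = `|(f v : R) - f u| by [].
have -> : mdist u v = `|r| + `|r| by move: uv; rewrite /gp; lra.
have : `|f u : R| = `|r| by rewrite /f; case: ifP; rewrite ?normrN au normr_id.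
have : `|f v : R| = `|r| by rewrite /f; case: ifP; rewrite ?normrN av normr_id.
move=> /eqP; rewrite eqr_norm2 => /orP[/eqP|/eqP fv]; first by exists v.
move=> /eqP; rewrite eqr_norm2 => /orP[/eqP|/eqP fu]; first by exists u.
rewrite fu fv subrr normr0 => r0; exists u; rewrite fu.
by move/eqP: r0; rewrite eq_sym -mulr2n mulrn_eq0 /= normr_eq0 => /eqP ->; rewrite oppr0.
Qed.

Lemma tripod_transfer p q x y z : tripod_at p x y z ->
  exists x' y' z', tripod_at q x' y' z'.
Proof.
move=> [[px py pz] xy yz xz]; have [f [fE fp]] := hom p q.
exists (f x), (f y), (f z); rewrite /tripod_at -fp !gromov_product_isometry //.
by rewrite -!mdist_gt0 !fE !mdist_gt0.
Qed.

(* Each of [u] and [v] lies in the direction of at most one leg of the tripod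
   carried to [q] by homogeneity, so some leg avoids both directions. *)
Lemma tripod_escape (p x y z q u v : X) (L : R) : tripod_at p x y z -> 0 < L ->
  exists w, [/\ mdist q w = L, gp q u w = 0 & gp q v w = 0].
Proof.
move=> /(tripod_transfer q) [x1 [x2 [x3 [[n1 n2 n3] g12 g23 g13]]]] L0.
have [x0 [n0 ux vx]] : exists x0, [/\ q != x0, gp q u x0 = 0 & gp q v x0 = 0].
  have one w a b : gp q a b = 0 -> gp q w a = 0 \/ gp q w b = 0.
    move=> ab; have := hyp q a w b; rewrite ab ge_min gromov_productC => /orP[] h.
      by left; apply/le_anti; rewrite h gromov_product_ge0.
    by right; apply/le_anti; rewrite h gromov_product_ge0.
  have [u1 u2 u3] := And3 (one u _ _ g12) (one u _ _ g23) (one u _ _ g13).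
  have [v1 v2 v3] := And3 (one v _ _ g12) (one v _ _ g23) (one v _ _ g13).
  by case: u1 u2 u3 => ? [] ? [] ?; case: v1 v2 v3 => ? [] ? [] ?;
    solve [by exists x1|by exists x2|by exists x3].
(* [x0] may be closer to [q] than [L], so the leg is prolonged by [L] beyond [x0] and then cut at
   distance [L] from [q]. *)
have [w [xw gw]] := escape x0 q n0 (ltW L0).
have q0 : 0 < mdist q x0 by rewrite mdist_gt0.
have qw : mdist q w = mdist q x0 + L.
  by move: gw; rewrite /gp (metric_sym x0 q) xw; lra.
have [|c qc cw] := @geodesic_point _ _ q w L geo; first by rewrite qw; lra.
have cx : 0 < gp q c x0.
  apply: (gromov_product_trans (y := w) hyp).
    by rewrite /gp qc cw qw; lra.
  by rewrite /gp (metric_sym w) xw qw; lra.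
have away t : gp q t x0 = 0 -> gp q t c = 0.
  move=> tx; apply/le_anti; rewrite gromov_product_ge0 andbT leNgt.
  by apply/negP => tc; have := gromov_product_trans hyp tc cx; rewrite tx ltxx.
by exists c; split=> //; apply: away.
Qed.

(* Branch off a segment of length [e] issuing from [p], at distinct points. *)
Lemma bouquet (p x y z q : X) (e : R) : tripod_at p x y z -> 0 < e < 1 ->
  exists s : nat -> X, (forall i, mdist q (s i) = 1) /\
    forall i j, i != j -> gp q (s i) (s j) <= e.
Proof.
move=> tri /andP[e0 e1]; have [[px _ _] _ _ _] := tri.
have [b [qb _]] := escape q q px (ltW e0).
(* Pairwise distinct heights at which the branches leave the segment from [q] to [b]. *)
pose t (i : nat) : R := e / i.+1%:R.
have t_gt0 i : 0 < t i by rewrite divr_gt0.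
have t_le i : t i <= e by rewrite ler_pdivrMr // ler_peMr ?(ltW e0) // ler1n.
have t_inj i j : i != j -> t i != t j.
  apply: contraNneq => /(mulfI (lt0r_neq0 e0)) /invr_inj /eqP.
  by rewrite eqr_nat eqSS.
have pt i : exists w, mdist q w = 1 /\ gp q w b = t i.
  have [|c qc cb] := @geodesic_point _ _ q b (t i) geo.
    by rewrite qb t_le ltW.
  (* Avoiding both [q] and [b] makes the branch leave the segment exactly at height [t i]; the
     length [1 - t i] puts its end at distance 1 from [q]. *)
  have [|w [cw qw bw]] := tripod_escape c q b (L := 1 - t i) tri.
    by have := t_le i; lra.
  exists w; move: qw bw; rewrite /gp (metric_sym c q) qc (metric_sym b w) cb.
  by rewrite qb cw => qw bw; have t0 := t_gt0 i; split; lra.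
have [s sP] := choice pt; exists s; split=> [i|i j ij]; first by have [] := sP i.
(* By [hyp], two branches share no more than the lower of their heights. *)
have key k l : t k < t l -> gp q (s k) (s l) <= e.
  move=> kl; have [_ gk] := sP k; have [_ gl] := sP l.
  have := hyp q (s k) (s l) b; rewrite gk gl ge_min => /orP[] h; last by lra.
  exact: le_trans h (t_le k).
have := t_inj i j ij; rewrite neq_lt => /orP[/key //|/key].
by rewrite gromov_productC.
Qed.

End HomogeneousTree.

(** * Components of a punctured 0-hyperbolic space *)

Section Components.
Variables (R : realType) (X : metricType R).
Hypothesis hyp : zero_hyperbolic X.
Implicit Types p x y z : X.

Lemma gromov_product_ball p x y : ball x (mdist p x) y ->
  0 < gromov_product p x y.
Proof.
rewrite ballEmdist /= => xy; have := metric_triangle p y x.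
by rewrite (metric_sym y x) /gromov_product; lra.
Qed.

Lemma open_same_side p x : open [set z | 0 < gromov_product p z x].
Proof.
rewrite openE => z /= zx; apply/nbhs_ballP; exists (mdist p z) => /=.
  exact: lt_le_trans zx (gromov_product_lel p z x).
move=> w /gromov_product_ball zw; rewrite /= in zw *.
by apply: (gromov_product_trans hyp _ zx); rewrite gromov_productC.
Qed.

Lemma open_other_side p x : open [set z | p != z /\ gromov_product p z x <= 0].
Proof.
rewrite openE => z /= [pz zx]; apply/nbhs_ballP; exists (mdist p z) => /=.
  by rewrite mdist_gt0.
move=> w /gromov_product_ball zw; split.
  rewrite -mdist_gt0 (lt_le_trans zw) // gromov_productC.
  exact: gromov_product_lel.
rewrite leNgt; apply/negP => wx.
by have := gromov_product_trans hyp zw wx; rewrite ltNge zx.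
Qed.

(** Within the component of [x], the points in the direction of [x] form a nonempty open and closed
    subset, hence the whole component; [y] is not among them. *)
Lemma component_gromov_product p x y : p != x -> p != y ->
  gromov_product p x y = 0 ->
  connected_component (~` [set p]) x <> connected_component (~` [set p]) y.
Proof.
move=> px py xy comp; set C := connected_component _ x in comp.
have Cx : C x by apply: connected_component_refl => /= xp; rewrite xp eqxx in px.
have Cy : C y.
  by rewrite comp; apply: connected_component_refl => /= yp; rewrite yp eqxx in py.
have Cp z : C z -> p != z.
  by move=> Cz; apply/eqP => pz; apply: (connected_component_sub Cz).
have CE : C `&` [set z | 0 < gromov_product p z x] = C.
  apply: component_connected.
  - by exists x; split=> //=; rewrite gromov_productxx mdist_gt0.
  - by exists [set z | 0 < gromov_product p z x] => //; exact: open_same_side.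
  - exists (~` [set z | p != z /\ gromov_product p z x <= 0]).
      exact/open_closedC/open_other_side.
    apply/seteqP; split=> z /= [Cz zx]; split=> //.
      by move=> [_]; rewrite leNgt zx.
    by rewrite ltNge; apply/negP => zx0; apply: zx; split=> //; exact: Cp.
have : (C `&` [set z | 0 < gromov_product p z x]) y by rewrite CE.
by move=> [_ /=]; rewrite gromov_productC xy ltxx.
Qed.

End Components.

(** * Cayley graphs: left translations, vertices and countability *)

Section CayleyVertices.
Variables (R : realType) (G : groupType) (S : finite_symmetric_generating_set G).
Local Notation Gr := (cayley_graph S).
Local Open Scope group_scope.

Lemma cayley_adj_mul (k g h : G) : cayley_adj S g h -> cayley_adj S (k * g) (k * h).
Proof. by move=> [s Ss <-]; exists s; rewrite ?mulgA. Qed.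

Definition translate (k : G) (x : graph_pt R Gr) : graph_pt R Gr :=
  match x with
  | vertex_pt v => @vertex_pt R Gr (k * v)
  | edge_pt v w t e t01 => @edge_pt R Gr (k * v) (k * w) t (cayley_adj_mul k e) t01
  end.

Lemma on_edge_translate (k v w : G) (x : graph_pt R Gr) (t : R) :
  @on_edge R Gr v w x t -> @on_edge R Gr (k * v) (k * w) (translate k x) t.
Proof.
case=> [||{}t e t01|{}t e t01 vw].
- exact: on_edge_source.
- exact: on_edge_target.
- exact: on_edge_inner.
- by apply: on_edge_flip => /mulgI.
Qed.

Lemma path_length_translate (k : G) (x y : graph_pt R Gr) (l : R) :
  path_length x y l -> path_length (translate k x) (translate k y) l.
Proof.
elim=> [z|{}x {}y z a {}l [v w s t e xs yt] _ IH]; first exact: path_length_nil.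
apply: path_length_cons IH.
by apply: (@EdgeSegment R Gr _ _ (k * v) (k * w) s t (cayley_adj_mul k e));
  exact: on_edge_translate.
Qed.

Lemma path_dist_translate (k : G) (x y : graph_pt R Gr) :
  path_dist (translate k x) (translate k y) <= path_dist x y.
Proof.
apply: lb_le_inf; first exact: path_length_ex.
by move=> l /= xy; apply: path_dist_le; exact: path_length_translate.
Qed.

Lemma cayley_vertex_translate (k g h : G) :
  mdist (cayley_vertex R S (k * g)) (cayley_vertex R S (k * h)) =
  mdist (cayley_vertex R S g) (cayley_vertex R S h).
Proof.
have le (a b c : G) :
    mdist (cayley_vertex R S (a * b)) (cayley_vertex R S (a * c)) <=
    mdist (cayley_vertex R S b) (cayley_vertex R S c).
  rewrite /cayley_vertex /vertex !graph_distE.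
  exact: (path_dist_translate a (@vertex_pt R Gr b) (@vertex_pt R Gr c)).
apply/le_anti; rewrite le /=.
by have := le k^-1 (k * g) (k * h); rewrite !mulgA !mulVg !mul1g.
Qed.

(** Lets cone points be given by sequences of group elements: an error of 1 vanishes after division
    by an infinite scaling factor. *)
Lemma near_vertex (y : cayley_space R S) :
  exists g : G, (mdist (cayley_vertex R S g) y <= 1)%R.
Proof.
have : exists v : G, @path_dist R Gr (@vertex_pt R Gr v) (repr y) <= 1%R.
  case: (repr y) => [v|v w t e t01].
    by exists v; rewrite path_distxx ler01.
  exists v; apply: le_trans (_ : `|0 - t| <= 1)%R.
    apply/path_dist_le/path_length_seg/(EdgeSegment e).
      exact: on_edge_source.
    exact: on_edge_inner.
  by case/andP: t01 => t0 t1; rewrite sub0r normrN ger0_norm ltW.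
by move=> [g gy]; exists g; rewrite -[y]reprK /cayley_vertex /vertex graph_distE.
Qed.

End CayleyVertices.

Lemma countable_group (G : groupType) (S : finite_symmetric_generating_set G) :
  exists f : G -> nat, injective f.
Proof.
have /finite_seqP[s sE] := generators_finite S.
(* Words are lists of positions in [s]; positions out of range stand for the neutral element. *)
pose w (l : seq nat) : G := foldr (fun i g => nth 1 s i * g)%g 1%g l.
have wM k l : w (k ++ l) = (w k * w l)%g.
  by elim: k => [|i k IH] /=; rewrite ?mul1g // IH mulgA.
have wS g : generators S g -> exists l, w l = g.
  rewrite sE /= => gs; exists [:: index g s].
  by rewrite /= mulg1 nth_index.
have wT : [set g | exists l, w l = g] = setT.
  apply: (generators_generate (f := S)) => //=.
  - by exists [::].
  - by move=> _ _ [k <-] [l <-]; exists (k ++ l); rewrite wM.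
  - move=> _ [l <-]; elim: l => [|i l [k kE]]; first by exists [::]; rewrite invg1.
    have [j jE] : exists j, w j = ((nth 1 s i)^-1)%g.
      have [si|si] := ltnP i (size s); last by exists [::]; rewrite nth_default ?invg1.
      by apply/wS/generatorsV; rewrite sE /=; exact: mem_nth.
    by exists (k ++ j); rewrite wM kE jE -invgM.
have /choice[f fw] : forall g, exists l, w l = g.
  by move=> g; have : [set g | exists l, w l = g] g by rewrite wT.
by exists (pickle \o f) => g h /(pcan_inj pickleK) fE; rewrite -(fw g) fE fw.
Qed.

(** * Diagonal choice along the ultrafilter *)

Section UltrafilterDiagonal.
Variable U : nonprincipal_ultrafilter.
Local Notation inU := (ultra_sets U).

Lemma ultra_ge (m : nat) : inU [set n | (m <= n)%N].
Proof.
elim: m => [|m IH]; first exact: filterE.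
have [mU|] := in_ultra_setVsetC [set m] (ultra_ultra U).
  by case: (ultra_nonprincipal mU).
by apply: filterS2 IH => n /= mn /eqP nm; rewrite ltn_neqAle eq_sym nm.
Qed.

(** If some [m <= n] satisfies [E m n], then [M n] is chosen to bound all such [m] and to satisfy
    [E (M n) n]. For fixed [m], the condition [m <= n] holds on a set of the ultrafilter. *)
Lemma ultra_diagonal (E : nat -> set nat) : (forall m, inU (E m)) ->
  exists M : nat -> nat, forall m, inU [set n | (m <= M n)%N /\ E (M n) n].
Proof.
move=> EU.
have /choice[M MP] : forall n, exists M, forall m, (m <= n)%N -> E m n ->
    (m <= M)%N /\ E M n.
  move=> n; have: exists M, forall m, (m <= n)%N -> E m n -> (m <= M)%N /\ E M n.
    elim: {1}n => [|k [M MP]].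
      by exists 0 => m; rewrite leqn0 => /eqP -> .
    have [Ek|nEk] := pselect (E k.+1 n); first by exists k.+1.
    exists M => m; rewrite leq_eqVlt => /orP[/eqP -> //|]; exact: MP.
  by [].
by exists M => m; apply: filterS2 (EU m) (ultra_ge m) => n Em mn; exact: MP.
Qed.

End UltrafilterDiagonal.

Lemma invr_natSS_lt (R : realType) (e : R) : 0 < e -> exists m : nat, m.+2%:R^-1 < e.
Proof.
move=> e0; have /archi_boundP : 0 <= e^-1 by rewrite invr_ge0 ltW.
move: (Num.bound _) => m em; exists m.
rewrite invf_plt ?posrE ?ltr0n //; apply: lt_le_trans em _.
by rewrite ler_nat -addn2 leq_addr.
Qed.

(** * Cone points as sequences of group elements *)

Section GroupCone.
Variables (R : realType) (U : nonprincipal_ultrafilter) (G : groupType)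
  (S : finite_symmetric_generating_set G) (g : ultrapower U G)
  (nu : scaling_factor U R).
Local Notation inU := (ultra_sets U).
Local Notation C := (group_cone S g nu).
Local Notation Y := (cayley_space R S).
Implicit Types (u v : nat -> G) (a b c : C).

Definition hvertex u : ultrapower U Y := hclass U (fun n => cayley_vertex R S (u n)).

Definition represents u c : Prop :=
  val c = (\pi_(cone_quotient Y nu) (hvertex u))%qT.

Definition vertex_dist u v (n : nat) : R :=
  mdist (cayley_vertex R S (u n)) (cayley_vertex R S (v n)) / scaling_seq nu n.

Lemma scaled_dist_hvertex u v :
  inU [set n | scaled_dist nu (hvertex u) (hvertex v) n = vertex_dist u v n].
Proof.
apply: filterS2 (repr_hclass U (fun n => cayley_vertex R S (u n)))
  (repr_hclass U (fun n => cayley_vertex R S (v n))) => n /= un vn.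
by rewrite /scaled_dist /hvertex un vn.
Qed.

Lemma represents_bounded u c : represents u c ->
  big_O (hdist (hvertex u) (hmap (@cayley_vertex R G S) g)) nu.
Proof. by move=> uc; apply/in_coneE; rewrite -uc; exact: valP c. Qed.

Lemma represents_dist u v a b : represents u a -> represents v b ->
  vertex_dist u v @ inU --> mdist a b.
Proof.
move=> ua vb; rewrite (cone_distE ua vb) hdist_divE.
pose p := hmap (@cayley_vertex R G S) g; have /big_OE[M uM] := represents_bounded ua.
have /big_OE[N vN] := represents_bounded vb.
have fin : finite_hyper (hclass U (scaled_dist nu (hvertex u) (hvertex v))).
  apply/finite_hyperE; exists (M + N).
  have tr := scaled_dist_triangle nu (hvertex u) p (hvertex v).
  apply: filterS3 (filterI uM vN) tr (scaled_dist_ge0 nu (hvertex u) (hvertex v)).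
  move=> n /= [un vn] + /ger0_norm ->; rewrite (scaled_dist_sym nu p).
  by move=> /le_trans; apply; exact: lerD.
have := finite_st fin; apply: cvg_trans; apply: near_eq_cvg.
exact: scaled_dist_hvertex.
Qed.

Lemma represents_near u v b (M : R) : represents v b ->
  inU [set n | vertex_dist u v n <= M] -> exists c, represents u c.
Proof.
move=> vb uM; set p := hmap (@cayley_vertex R G S) g.
have /big_OE[N vN] := represents_bounded vb.
have uO : big_O (hdist (hvertex u) p) nu.
  apply/big_OE; exists (M + N).
  apply: filterS3 (filterI uM vN) (scaled_dist_triangle nu (hvertex u) (hvertex v) p)
    (scaled_dist_hvertex u v) => n /= [un vn] tr E.
  by apply: le_trans tr _; rewrite E; exact: lerD.
have inC : in_cone p (\pi_(cone_quotient Y nu) (hvertex u))%qT by apply/in_coneE.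
by exists (exist (fun c : cone_quotient Y nu => is_true (in_cone p c)) _ inC).
Qed.

Lemma represents_ex c : exists u, represents u c.
Proof.
have [u uP] := choice (fun n => near_vertex (repr (repr (val c)) n)).
exists u; rewrite /represents -[LHS]reprK; apply/esym/eqP; rewrite eqmodE.
apply/cone_eqE/cvgrPdist_lt => e e0.
apply: filterS2 (repr_hclass U (fun n => cayley_vertex R S (u n)))
  (scaling_gt nu e^-1) => n /= un en.
have nu0 : 0 < scaling_seq nu n by apply: lt_trans en; rewrite invr_gt0.
rewrite /scaled_dist /hvertex un sub0r normrN ger0_norm; last first.
  by rewrite divr_ge0 ?mdist_ge0 // ltW.
rewrite ltr_pdivrMr //; apply: le_lt_trans (uP n) _.
by rewrite -ltr_pdivrMl // mulr1.
Qed.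

Lemma represents_inj u a b : represents u a -> represents u b -> a = b.
Proof. by move=> ua ub; apply: val_inj; rewrite ua ub. Qed.

(** Left multiplication by [k n] in coordinate [n] preserves [vertex_dist] exactly and takes the
    sequence of [p] to that of [q]. *)
Lemma group_cone_homogeneous : homogeneous C.
Proof.
move=> p q; have [rho rhoP] := choice represents_ex.
pose k n : G := (rho q n * (rho p n)^-1)%g.
pose tr u n : G := (k n * u n)%g.
have trE u v : vertex_dist (tr u) (tr v) = vertex_dist u v.
  by apply/funext => n; rewrite /vertex_dist /tr cayley_vertex_translate.
have trp : tr (rho p) = rho q.
  by apply/funext => n; rewrite /tr /k -mulgA mulVg mulg1.
have /choice[f fP] : forall x : C, exists y : C, represents (tr (rho x)) y.
  move=> x; have /cvgrPdist_lt/(_ 1 ltr01) := represents_dist (rhoP x) (rhoP p).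
  move=> near1; apply: (represents_near (M := mdist x p + 1) (rhoP q)).
  rewrite -trp trE; apply: filterS near1 => n /=.
  by rewrite ltr_norml => /andP[]; lra.
exists f; split=> [x y|].
  have := represents_dist (fP x) (fP y); rewrite trE => xy.
  exact: (cvg_unique (@Rhausdorff R) xy (represents_dist (rhoP x) (rhoP y))).
by apply: represents_inj (fP p) _; rewrite trp; exact: rhoP.
Qed.

Lemma group_cone_countable_words : exists f : C -> nat -> nat, injective f.
Proof.
have [rho rhoP] := choice represents_ex; have [e einj] := countable_group S.
exists (fun c n => e (rho c n)) => a b ab.
apply: represents_inj (rhoP a) _; suff -> : rho a = rho b by exact: rhoP.
by apply/funext => n; apply: einj; exact: (congr1 (@^~ n) ab).
Qed.

(** A set is read as an infinite binary word. At index [n], its point follows the member of family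
    [M n] named by the prefix of length [M n]. As [M n] tends to infinity along the ultrafilter,
    distinct sets get distinct prefixes and the bounds on the products shrink to 0. *)
Lemma group_cone_saturated (p : C) (z : nat -> nat -> C) :
  (forall m i, mdist p (z m i) = 1) ->
  (forall m i j, i != j -> gromov_product p (z m i) (z m j) <= m.+2%:R^-1) ->
  exists Z : set nat -> C, (forall A, mdist p (Z A) = 1) /\
    forall A B, A <> B -> gromov_product p (Z A) (Z B) = 0.
Proof.
move=> z1 zgp; have [rho rhoP] := choice represents_ex.
pose e (m : nat) : R := m.+2%:R^-1.
have e_gt0 m : 0 < e m by rewrite invr_gt0.
have e_le k m : (k <= m)%N -> e m <= e k.
  by move=> km; rewrite lef_pV2 ?posrE // ler_nat.
pose w m (t : m.-tuple bool) := z m (pickle (tval t)).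
(* Products at most [e m] mean distances at least [2 - 2 * e m], and approximation at index [n]
   costs one more [e m]. There are finitely many tuples for each [m], so [E m] is in the
   ultrafilter. *)
pose E m := [set n | forall t t' : m.-tuple bool,
  `|1 - vertex_dist (rho (w m t)) (rho p) n| < e m /\
  (t != t' -> 2 - 3 * e m <= vertex_dist (rho (w m t)) (rho (w m t')) n)].
have EU m : inU (E m).
  apply: filter_forall => t; apply: filter_forall => t'.
  have := represents_dist (rhoP (w m t)) (rhoP p).
  rewrite metric_sym z1 => /cvgrPdist_lt/(_ _ (e_gt0 m)) near1.
  have := represents_dist (rhoP (w m t)) (rhoP (w m t')).
  move=> /cvgrPdist_lt/(_ _ (e_gt0 m)) near2.
  apply: filterS2 near1 near2 => n /= n1 n2; split=> // tt'.
  have : pickle (tval t) != pickle (tval t').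
    by apply: contraNneq tt' => /(pcan_inj pickleK) /val_inj ->.
  move=> /(zgp m); rewrite /gromov_product !z1 -/(w m t) -/(w m t') -/(e m).
  by move: n2; rewrite ltr_norml => /andP[]; lra.
have [M MP] := ultra_diagonal EU.
pose code A m : m.-tuple bool := [tuple `[< A (i : nat) >] | i < m].
pose u A n := rho (w (M n) (code A (M n))) n.
have u1 A : vertex_dist (u A) (rho p) @ inU --> (1 : R).
  apply/cvgrPdist_lt => r r0; have [m mr] := invr_natSS_lt r0.
  apply: filterS (MP m) => n /= [mM /(_ (code A _) (code A _)) [h _]].
  exact: lt_trans (lt_le_trans h (e_le _ _ mM)) mr.
have /choice[Z ZP] : forall A, exists c, represents (u A) c.
  move=> A; apply: (represents_near (M := 2) (rhoP p)).
  have /cvgrPdist_lt/(_ 1 ltr01) := u1 A; apply: filterS => n /=.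
  by rewrite ltr_norml => /andP[]; lra.
have Z1 A : mdist p (Z A) = 1.
  rewrite metric_sym.
  exact: (cvg_unique (@Rhausdorff R) (represents_dist (ZP A) (rhoP p)) (u1 A)).
exists Z; split=> // A B AB; apply/le_anti; rewrite gromov_product_ge0 andbT.
rewrite /gromov_product !Z1 leNgt; apply/negP => ZAB.
have [i Ai] : exists i, `[< A i >] != `[< B i >].
  apply: contrapT => /forallNP AB'; apply: AB; apply/funext => i.
  have /negP := AB' i; rewrite negbK => /eqP ABi.
  by rewrite -(asboolE (A i)) ABi asboolE.
have [m mlt] : exists m, e m < (2 - mdist (Z A) (Z B)) / 3.
  by apply: invr_natSS_lt; move: ZAB; lra.
have : 2 - 3 * e m <= mdist (Z A) (Z B).
  apply: (ler_cvg_to (@cvg_cst _ (2 - 3 * e m) _ inU _) (represents_dist (ZP A) (ZP B))).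
  (* [i < M n] makes both prefixes long enough to differ at position [i]. *)
  apply: filterS2 (MP m) (MP i.+1) => n /= [mM /(_ (code A _) (code B _)) [_ h]] [iM _].
  apply: le_trans (h _); first by have := e_le _ _ mM; lra.
  apply: contraNneq Ai => /(congr1 (fun t => tnth t (Ordinal iM))).
  by rewrite !tnth_mktuple => ->.
by move: mlt; lra.
Qed.

End GroupCone.

(** * Transfer to isometric trees and the trichotomy *)

Lemma group_cone_inhabited (R : realType) (U : nonprincipal_ultrafilter)
    (G : groupType) (S : finite_symmetric_generating_set G)
    (g : ultrapower U G) (nu : scaling_factor U R) :
  inhabited (group_cone S g nu).
Proof.
set p := hmap (@cayley_vertex R G S) g.
have inC : in_cone p (\pi_(cone_quotient (cayley_space R S) nu) p)%qT.
  apply/in_coneE/big_OE; exists 0; apply: filterE => n /=.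
  by rewrite /scaled_dist mdistxx mul0r.
constructor.
exact: (exist (fun c : cone_quotient (cayley_space R S) nu => is_true (in_cone p c)) _ inC).
Qed.

Lemma isometry_inj (R : realType) (X Y : metricType R) (f : X -> Y) :
  (forall x y, mdist (f x) (f y) = mdist x y) -> injective f.
Proof.
move=> fE x y fxy; have : mdist (f x) (f y) = 0 by rewrite fxy mdistxx.
by rewrite fE => /mdist_positivity.
Qed.

Lemma isometric_homogeneous (R : realType) (X Y : metricType R) :
  isometric X Y -> homogeneous Y -> homogeneous X.
Proof.
move=> [f [fE /choice[h fh]]] hom p q; have [k [kE kp]] := hom (f p) (f q).
exists (fun x => h (k (f x))); split=> [x y|]; first by rewrite -fE !fh kE fE.
by apply: (isometry_inj fE); rewrite fh kp.
Qed.

(** A function is recovered from its graph, coded as a set of natural numbers. *)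
Lemma card_words_le (T : Type) (f : T -> nat -> nat) : injective f ->
  ([set: T] #<= [set: set nat])%card.
Proof.
move=> finj; apply/pcard_injP.
exists (fun x => [set n | exists k, n = pickle (k, f x k)]) => x y _ _ /seteqP[xy _].
apply: finj; apply/funext => k; have [|l] := xy (pickle (k, f x k)); first by exists k.
by move/(pcan_inj pickleK) => [-> ->].
Qed.

Theorem theorem1p3 (R : realType) (U : nonprincipal_ultrafilter)
    (X : metricType R)
    (X_tree : real_tree X)
    (X_cone : exists (G : groupType) (S : finite_symmetric_generating_set G)
       (g : ultrapower U G) (nu : scaling_factor U R),
       isometric X (group_cone S g nu)) :
  is_point X \/ isometric X R^o \/
  (real_tree X /\ forall p : X, (branches p #= [set: set nat])%card).
Proof.
have [G [S [g [nu XC]]]] := X_cone; have [F [FE Fsurj]] := XC.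
have hyp := real_tree_zero_hyperbolic X_tree; have [_ geo _] := X_tree.
have hom := isometric_homogeneous XC (@group_cone_homogeneous _ _ _ S g nu).
have [c0] := group_cone_inhabited S g nu; have [a _] := Fsurj c0.
have [pt|npt] := pselect (is_point X); first by left.
right; have [b ab] : exists b, a != b.
  apply: contrapT => /forallNP ab; apply: npt; exists a => b.
  by apply/eqP; rewrite eq_sym; have /negP := ab b; rewrite negbK.
have [[q [x [y [z tri]]]]|notri] :=
    pselect (exists q x y z : X, tripod_at q x y z); last first.
  left; apply: (no_tripod_line geo hyp hom ab) => q x y z tri.
  by apply: notri; exists q, x, y, z.
(* Upper bound: branches are indexed by points of [X], hence by sequences of naturals. Lower bound:
   sets of naturals inject into the branches. *)
right; split=> // p; apply/card_eqPle; split.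
  have [f finj] := group_cone_countable_words S g nu.
  apply: card_le_trans (card_image_le _ _) _; apply: card_le_trans (card_leT _) _.
  by apply: (@card_words_le X (f \o F)); apply: inj_comp finj (isometry_inj FE).
(* [m.+2] rather than [m.+1] keeps the bound below 1 at [m = 0], as [bouquet] requires. *)
have /choice[s sP] : forall m : nat, exists s : nat -> X,
    (forall i, mdist p (s i) = 1) /\
    forall i j, i != j -> gromov_product p (s i) (s j) <= m.+2%:R^-1.
  move=> m; apply: (bouquet geo hyp hom _ tri).
  by rewrite invr_gt0 ltr0n /= invf_lt1 ?ltr1n.
have [m i|m i j ij|Z [Z1 ZAB]] :=
    @group_cone_saturated _ _ _ S g nu (F p) (fun m i => F (s m i)).
- by rewrite FE; have [] := sP m.
- by rewrite /gromov_product !FE; have [_] := sP m; apply.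
have [h hF] := choice (fun A => Fsurj (Z A)).
have pN A : p != h A by rewrite -mdist_gt0 -FE hF Z1.
pose phi A := connected_component (~` [set p]) (h A).
have phi_inj : injective phi.
  move=> A B AB; apply: contrapT => /ZAB gp0.
  apply: (component_gromov_product hyp (pN A) (pN B) _ AB).
  by rewrite /gromov_product -!FE !hF.
have /card_eqPle[_ /card_le_trans] : (range phi #= [set: set nat])%card.
  by apply: inj_card_eq => A B _ _; exact: phi_inj.
apply; apply: subset_card_le => _ [A _ <-]; exists (h A) => //=.
by move=> hA; have := pN A; rewrite hA eqxx.
Qed.
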